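(* Let $\chi$ and $\check\phi$ be formulas over $\vec{x}$ and $\vec{a}:\mathbb{Z}^d\to\mathbb{Z}^d$ such that for all $\vec{x}\in\mathbb{Z}^d$: $\check\phi(\vec{x})\land\chi(\vec{x})\implies\chi(\vec{a}(\vec{x}))$. Then the conditional acceleration technique $(\langle\chi,\vec{a}\rangle,\check\phi)\mapsto \vec{x}'=\vec{a}^n(\vec{x})\land\chi(\vec{x})$ (defined on all such pairs) is exact. Explicitly: for all $\vec{x},\vec{x}'\in\mathbb{Z}^d$ and $n>0$, (i) if $\vec{x}\longrightarrow^n_{\langle\check\phi,\vec{a}\rangle}\vec{x}'$, $\vec{x}'=\vec{a}^n(\vec{x})$ and $\chi(\vec{x})$, then $\vec{x}\longrightarrow^n_{\langle\chi,\vec{a}\rangle}\vec{x}'$; and (ii) if $\vec{x}\longrightarrow^n_{\langle\chi\land\check\phi,\vec{a}\rangle}\vec{x}'$, then $\vec{x}'=\vec{a}^n(\vec{x})$ and $\chi(\vec{x})$.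
   Context: $\vec{x}=(x_1,\dots,x_d)$ ranges over $\mathbb{Z}^d$, $n$ is a variable, $\vec{x}'=(x_1',\dots,x_d')$. Formulas are finite quantifier-free propositional formulas with atoms $p>0$, $p$ a closed-form arithmetic expression. For a formula $\phi$ over $\vec{x}$ and $\vec{a}:\mathbb{Z}^d\to\mathbb{Z}^d$, the loop $\langle\phi,\vec{a}\rangle$ induces $\vec{x}\longrightarrow_{\langle\phi,\vec{a}\rangle}\vec{x}'$ iff $\phi(\vec{x})\land\vec{x}'=\vec{a}(\vec{x})$; $\longrightarrow^n$ is its $n$-fold composition, and $\vec{a}^n$ is the $n$-fold application of $\vec{a}$ ($\vec{a}^0=\mathrm{id}$). A conditional acceleration technique is a partial function $\mathit{accel}$ mapping pairs (loop $\langle\chi,\vec{a}\rangle$, formula $\check\phi$) to formulas over $(\vec{x},n,\vec{x}')$; it is sound if for all arguments in its domain, $\vec{x},\vec{x}'\in\mathbb{Z}^d$, $n>0$: $\vec{x}\longrightarrow^n_{\langle\check\phi,\vec{a}\rangle}\vec{x}'\land\mathit{accel}(\langle\chi,\vec{a}\rangle,\check\phi)$ implies $\vec{x}\longrightarrow^n_{\langle\chi,\vec{a}\rangle}\vec{x}'$; exact if additionally $\vec{x}\longrightarrow^n_{\langle\chi\land\check\phi,\vec{a}\rangle}\vec{x}'$ implies $\mathit{accel}(\langle\chi,\vec{a}\rangle,\check\phi)$. *)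

(* Defs.v *)
From HB Require Import structures.
From mathcomp Require Import all_boot all_order all_algebra.

Set Implicit Arguments.
Unset Strict Implicit.
Unset Printing Implicit Defensive.

Import Order.TTheory GRing.Theory Num.Theory.
Local Open Scope ring_scope.

(* A closed-form expression over the variables [V] is represented by the
   function it denotes. The class of closed forms is left open and admits every
   function, so that [a^n(x)] is available for arbitrary updates [a]. Values
   live in a real domain [R], since closed forms need not be integer-valued. *)
Definition expr (R : realDomainType) (V : finType) : Type :=
  {ffun V -> int} -> R.

(* [FGt0 p] is the atom [p > 0]. *)
Inductive formula (R : realDomainType) (V : finType) : Type :=
| FTrue
| FGt0 of expr R V
| FNot of formula R V
| FAnd of formula R V & formula R V
| FOr of formula R V & formula R V.

Arguments FTrue {R V}.

Fixpoint sat (R : realDomainType) (V : finType) (phi : formula R V)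
    (v : {ffun V -> int}) : bool :=
  match phi with
  | FTrue => true
  | FGt0 p => 0 < p v
  | FNot phi1 => ~~ sat phi1 v
  | FAnd phi1 phi2 => sat phi1 v && sat phi2 v
  | FOr phi1 phi2 => sat phi1 v || sat phi2 v
  end.

Fixpoint frename (R : realDomainType) (V W : finType) (f : V -> W)
    (phi : formula R V) : formula R W :=
  match phi with
  | FTrue => FTrue
  | FGt0 p => FGt0 (fun w : {ffun W -> int} => p [ffun i => w (f i)])
  | FNot phi1 => FNot (frename f phi1)
  | FAnd phi1 phi2 => FAnd (frename f phi1) (frename f phi2)
  | FOr phi1 phi2 => FOr (frename f phi1) (frename f phi2)
  end.

(* The equation [p = q] in terms of strict atoms. *)
Definition FEq (R : realDomainType) (V : finType) (p q : expr R V) :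
    formula R V :=
  FAnd (FNot (FGt0 (fun v => p v - q v))) (FNot (FGt0 (fun v => q v - p v))).

Notation state d := {ffun 'I_d -> int}.

Record loop (R : realDomainType) (d : nat) := Loop {
  guard : formula R 'I_d;
  update : state d -> state d
}.

Definition step (R : realDomainType) (d : nat) (l : loop R d)
    (x x' : state d) : Prop :=
  sat (guard l) x /\ x' = update l x.

Fixpoint nsteps (R : realDomainType) (d : nat) (l : loop R d) (n : nat)
    (x x' : state d) : Prop :=
  if n is m.+1 then exists2 y, step l x y & nsteps l m y x' else x = x'.

(* The variables [x], [n], [x'] of the formulas that describe [n] iterations. *)
Definition accel_var (d : nat) : finType := ('I_d + unit + 'I_d)%type.
Definition pre (d : nat) (i : 'I_d) : accel_var d := inl (inl i).
Definition count_var (d : nat) : accel_var d := inl (inr tt).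
Definition post (d : nat) (i : 'I_d) : accel_var d := inr i.

Definition valuation (d : nat) (x : state d) (n : nat) (x' : state d) :
    {ffun accel_var d -> int} :=
  [ffun k : accel_var d =>
    match k with
    | inl (inl i) => x i
    | inl (inr _) => n%:Z
    | inr i => x' i
    end].

(* A partial function is given by its domain and a total function whose values
   outside the domain are irrelevant. *)
Record cond_accel_technique (R : realDomainType) (d : nat) := CondAccel {
  accel_dom : loop R d -> formula R 'I_d -> Prop;
  accel : loop R d -> formula R 'I_d -> formula R (accel_var d)
}.

Definition sound (R : realDomainType) (d : nat)
    (t : cond_accel_technique R d) : Prop :=
  forall (l : loop R d) (phi : formula R 'I_d), accel_dom t l phi ->
  forall (x x' : state d) (n : nat), (0 < n)%N ->
    nsteps (Loop phi (update l)) n x x' ->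
    sat (accel t l phi) (valuation x n x') ->
    nsteps l n x x'.

Definition exact (R : realDomainType) (d : nat)
    (t : cond_accel_technique R d) : Prop :=
  sound t /\
  forall (l : loop R d) (phi : formula R 'I_d), accel_dom t l phi ->
  forall (x x' : state d) (n : nat), (0 < n)%N ->
    nsteps (Loop (FAnd (guard l) phi) (update l)) n x x' ->
    sat (accel t l phi) (valuation x n x').

(* The formula [x' = a^n(x)]. Expressions are total, hence the absolute value:
   only positive [n] matter. *)
Definition FIter (R : realDomainType) (d : nat) (a : state d -> state d) :
    formula R (accel_var d) :=
  \big[@FAnd R (accel_var d) / FTrue]_(i < d)
    FEq (fun v => (v (post i))%:~R)
        (fun v => (iter `|v (count_var d)|%N a [ffun j => v (pre j)] i)%:~R).

Definition cond_invariant (R : realDomainType) (d : nat)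
    (chi phi : formula R 'I_d) (a : state d -> state d) : Prop :=
  forall x : state d, sat phi x /\ sat chi x -> sat chi (a x).

Definition preservation_accel (R : realDomainType) (d : nat) :
    cond_accel_technique R d :=
  CondAccel
    (fun l phi => cond_invariant (guard l) phi (update l))
    (fun l phi => FAnd (FIter R (update l)) (frename (@pre d) (guard l))).

Lemma sat_frename (R : realDomainType) (V W : finType) (f : V -> W)
    (phi : formula R V) (w : {ffun W -> int}) :
  sat (frename f phi) w = sat phi [ffun i => w (f i)].
Proof. by elim: phi => //= [? ->|? -> ? ->|? -> ? ->]. Qed.

Lemma sat_FEq (R : realDomainType) (V : finType) (p q : expr R V)
    (v : {ffun V -> int}) :
  sat (FEq p q) v = (p v == q v).
Proof. by rewrite /= !subr_gt0 -!leNgt -eq_le. Qed.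

Lemma valuation_pre (d : nat) (x : state d) (n : nat) (x' : state d) :
  [ffun i => valuation x n x' (pre i)] = x.
Proof. by apply/ffunP => i; rewrite !ffunE. Qed.

Lemma sat_FIter (R : realDomainType) (d : nat) (a : state d -> state d)
    (x : state d) (n : nat) (x' : state d) :
  sat (FIter R a) (valuation x n x') = (x' == iter n a x).
Proof.
rewrite /FIter (big_morph (fun phi => sat phi (valuation x n x'))
  (id1 := true) (op1 := andb)) // big_andE.
apply/forallP/eqP => [eq_x'|-> i].
  apply/ffunP => i; move: (eq_x' i).
  by rewrite sat_FEq valuation_pre eqr_int !ffunE => /eqP.
by rewrite sat_FEq valuation_pre eqr_int !ffunE eqxx.
Qed.

Lemma sat_preservation_accel (R : realDomainType) (d : nat) (l : loop R d)
    (phi : formula R 'I_d) (x : state d) (n : nat) (x' : state d) :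
  sat (accel (preservation_accel R d) l phi) (valuation x n x') =
  (x' == iter n (update l) x) && sat (guard l) x.
Proof. by rewrite [LHS]/= sat_FIter sat_frename valuation_pre. Qed.

(* Main.v *)
Require Import Defs.
From HB Require Import structures.
From mathcomp Require Import all_boot all_order all_algebra.

Set Implicit Arguments.
Unset Strict Implicit.
Unset Printing Implicit Defensive.

(** Updates are deterministic, so an [n]-step run is the orbit of [x] under [a] with the guard true
    at its first [n] points. Soundness: along a run guarded by [phi], invariance carries [chi] from
    each point to the next, starting from [x]. Exactness: a nonempty run guarded by [chi] and [phi]
    tests [chi] at [x] and ends at the [n]-th iterate. *)

Lemma nsteps_iter (R : realDomainType) (d : nat) (l : loop R d) (n : nat)
    (x x' : state d) :
  nsteps l n x x' -> x' = iter n (update l) x.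
Proof.
elim: n x => [|n IHn] x /=; first by move->.
by case=> y [_ ->] /IHn ->; rewrite -iterSr.
Qed.

Lemma nsteps_guard (R : realDomainType) (d : nat) (l : loop R d) (n : nat)
    (x x' : state d) :
  (0 < n)%N -> nsteps l n x x' -> sat (guard l) x.
Proof. by case: n => // n _ [y []]. Qed.

(** The first step supplies [phi] at [x]; with [chi] at [x] this gives [chi] at [a x], where the
    remaining run starts. *)
Lemma nsteps_cond_invariant (R : realDomainType) (d : nat)
    (chi phi : formula R 'I_d) (a : state d -> state d) (n : nat)
    (x x' : state d) :
  cond_invariant chi phi a -> sat chi x ->
  nsteps (Loop phi a) n x x' -> nsteps (Loop chi a) n x x'.
Proof.
move=> chi_inv; elim: n x => [|n IHn] x //= chi_x [y [phi_x ->] ax_x'].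
by exists (a x) => //; apply: IHn => //; apply: chi_inv.
Qed.

Theorem theorem8 (R : realDomainType) (d : nat) :
  exact (preservation_accel R d) /\
  (forall (chi phi : formula R 'I_d) (a : state d -> state d),
     (forall x : state d, sat phi x /\ sat chi x -> sat chi (a x)) ->
     forall (x x' : state d) (n : nat), (0 < n)%N ->
       (nsteps (Loop phi a) n x x' -> x' = iter n a x /\ sat chi x ->
        nsteps (Loop chi a) n x x') /\
       (nsteps (Loop (FAnd chi phi) a) n x x' ->
        x' = iter n a x /\ sat chi x)).
Proof.
have conj_steps (chi phi : formula R 'I_d) a x x' n : (0 < n)%N ->
    nsteps (Loop (FAnd chi phi) a) n x x' -> x' = iter n a x /\ sat chi x.
  (* Positivity of [n] matters here: an empty run tests no guard. *)
  by move=> n_gt0 xx'; have /andP[] := nsteps_guard n_gt0 xx';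
    rewrite (nsteps_iter xx').
split=> [|chi phi a chi_inv x x' n n_gt0]; last first.
  by split=> [xx' [_ chi_x]|]; [apply: nsteps_cond_invariant xx'|
                                apply: conj_steps].
(* [sat_preservation_accel] decodes the formula, reducing both halves of exactness to the semantic
   facts. *)
split=> -[chi a] phi chi_inv x x' n n_gt0 xx'.
  rewrite sat_preservation_accel => /andP[_ chi_x].
  exact: nsteps_cond_invariant xx'.
have [-> chi_x] := conj_steps _ _ _ _ _ _ n_gt0 xx'.
by rewrite sat_preservation_accel eqxx.
Qed.
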